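(* Every Wold isometry on a Banach space extends to a Banach space unitary. That is, if $V$ is a Wold isometry on a complex Banach space $\mathbb{X}$, then there exist a vector space $\mathbb{Y}$ with two complete norms $\|\cdot\|_\sigma,\|\cdot\|_{\mathbb{Y}}$, a surjective linear isometry $U:(\mathbb{Y},\|\cdot\|_\sigma)\to(\mathbb{Y},\|\cdot\|_{\mathbb{Y}})$, and a linear map $\Lambda:\mathbb{X}\to\mathbb{Y}$ that is isometric with respect to both $\|\cdot\|_\sigma$ and $\|\cdot\|_{\mathbb{Y}}$, such that $U\Lambda=\Lambda V$.
   Context: An isometry is a linear norm-preserving map; a Banach space unitary is a surjective isometry between Banach spaces. A Wold isometry on $\mathbb{X}$ is an isometry $V:\mathbb{X}\to\mathbb{X}$ such that $\mathbb{X}=\mathbb{X}_1\oplus\mathbb{X}_2$ (vector space direct sum) with $\mathbb{X}_1,\mathbb{X}_2$ invariant under $V$, $V|_{\mathbb{X}_1}$ a unitary (surjective isometry of $\mathbb{X}_1$), and $V|_{\mathbb{X}_2}$ a pure isometry (it has no nonzero closed invariant subspace on which it is a surjective isometry), where the subspaces are $\mathbb{X}_1=\bigcap_{n=0}^\infty V^n\mathbb{X}$ and $\mathbb{X}_2=\bigoplus_{n=0}^\infty V^n\mathcal{L}$ for some closed subspace $\mathcal{L}$ that is a vector space complement of $V\mathbb{X}$ in $\mathbb{X}$. Here $\mathbb{X}_2=\bigoplus_{n=0}^\infty V^n\mathcal{L}$ means every $x\in\mathbb{X}_2$ is uniquely a convergent series $x=\sum_{n=0}^\infty V^nl_n$ with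 $l_n\in\mathcal{L}$. *)

(* Defs.v *)
From HB Require Import structures.
From mathcomp Require Import all_boot all_order all_algebra.
From mathcomp Require Export complex.
From mathcomp Require Import all_classical all_reals all_analysis.

Set Implicit Arguments.
Unset Strict Implicit.
Unset Printing Implicit Defensive.

Import Order.TTheory GRing.Theory Num.Theory.
Import numFieldNormedType.Exports.

Local Open Scope classical_set_scope.
Local Open Scope ring_scope.

Section WoldIsometries.
Context {K : numFieldType} {X : normedModType K}.
Implicit Types (V : {linear X -> X}) (A B L M : set X).

Definition linear_subspace A : Prop := GRing.submod_closed (mem A).

Definition direct_sum A B : Prop :=
  [/\ linear_subspace A, linear_subspace B, A `&` B = [set 0] &
      forall x : X, exists a b : X, [/\ A a, B b & x = a + b]].

Definition isometry_on V A : Prop := forall x, A x -> `|V x| = `|x|.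

Definition unitary_on V A : Prop := isometry_on V A /\ V @` A = A.

(* In a Wold decomposition the second summand is automatically closed, so it
   is immaterial whether M is closed in X or relatively closed in A. *)
Definition pure_isometry_on V A : Prop :=
  isometry_on V A /\
  forall M, linear_subspace M -> closed M -> M `<=` A -> V @` M `<=` M ->
    unitary_on V M -> M = [set 0].

Definition orbit_sum V (l : nat -> X) (x : X) : Prop :=
  series (fun n => iter n V (l n)) @ \oo --> x.

Definition wold_isometry V : Prop :=
  (forall x, `|V x| = `|x|) /\
  exists L X1 X2 : set X,
  [/\ closed L, direct_sum (range V) L,
      X1 = \bigcap_n range (iter n V),
      X2 = [set x | exists2 l : nat -> X, forall n, L (l n) & orbit_sum V l x] &
      (forall x, X2 x ->
        exists! l : nat -> X, (forall n, L (l n)) /\ orbit_sum V l x)] /\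
  [/\ direct_sum X1 X2,
      V @` X1 `<=` X1, V @` X2 `<=` X2,
      unitary_on V X1 & pure_isometry_on V X2].

End WoldIsometries.

Section Norms.
Context {K : numFieldType}.

Record vs_norm (Y : lmodType K) := VsNorm {
  norm_of :> Y -> K;
  norm_ofD : forall x y, norm_of (x + y) <= norm_of x + norm_of y;
  norm_ofZ : forall a x, norm_of (a *: x) = `|a| * norm_of x;
  norm_of_eq0 : forall x, norm_of x = 0 -> x = 0 }.

(* The vector space Y with the norm N. *)
Definition normed_by (Y : lmodType K) (N : vs_norm Y) : Type := Y.

HB.instance Definition _ (Y : lmodType K) (N : vs_norm Y) :=
  GRing.Lmodule.on (normed_by N).
HB.instance Definition _ (Y : lmodType K) (N : vs_norm Y) :=
  Lmodule_isNormed.Build K (normed_by N)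
    (@norm_ofD Y N) (@norm_ofZ Y N) (@norm_of_eq0 Y N).

Definition complete_norm (Y : lmodType K) (N : vs_norm Y) : Prop :=
  forall F : set_system (normed_by N), ProperFilter F -> cauchy F -> cvg F.

End Norms.

(* Main.v *)
(** Only the isometry [V] and the closed complement [L] of [V X] matter.  Let
    [Y] be the space of bounded sequences [y] in [X] with [y_n \in L] for all
    [n >= 1], normed by the supremum norm [NY], and set
    [U (y_0, y_1, y_2, ...) = (V y_0 + y_1, y_2, ...)].  As [V] is injective and
    [X] is the direct sum of [V X] and [L], [U] is bijective, and
    [x |-> (x, 0, 0, ...)] is an isometric embedding of [X] intertwining [V]
    with [U].  Although [U] need not preserve [NY], it is tautologically an
    isometry from [Nsigma := NY \o U] to [NY]; [Nsigma] inherits completeness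
    from [NY], and it restricts to the norm of [X] because [V] is isometric. *)
Require Import Defs.
From HB Require Import structures.
From mathcomp Require Import all_boot all_order all_algebra.
From mathcomp Require Import all_classical all_reals all_analysis.
Import Order.TTheory GRing.Theory Num.Theory.
Import numFieldNormedType.Exports.
Local Open Scope classical_set_scope.
Local Open Scope ring_scope.
Local Open Scope complex_scope.

(** * Completeness of a norm and its transport along a bijection *)

Section CompleteNorms.
Context {K : numFieldType} {Y : lmodType K}.
Implicit Types N : vs_norm Y.

(** Speaks of [N] alone, so completeness can be compared for two norms on [Y]. The limit condition
    is non-strict because such bounds survive suprema. *)
Lemma complete_normP N : complete_norm N <->
  forall F : set_system Y, ProperFilter F ->
    (forall e : K, 0 < e -> exists x, F [set y | N (x - y) < e]) ->
    exists z, forall e : K, 0 < e -> F [set y | N (z - y) <= e].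
Proof.
have ballE x e : ball (x : normed_by N) e = [set y | N (x - y) < e].
  by rewrite -ball_normE.
split=> [cN F FF Fc|cN F FF /cauchyP Fc].
  have /cvg_ex[z Fz] : cvg (F : set_system (normed_by N)).
    by apply: cN; apply: cauchy_exP => e /Fc[x Fx]; exists x; rewrite ballE.
  by exists z; apply/(@cvgrPdist_le _ (normed_by N) _ F _ id).
have [|z Fz] := cN F FF.
  by move=> e /Fc[x]; rewrite ballE => Fx; exists x.
apply/cvg_ex; exists z.
by apply/(@cvgrPdist_le _ (normed_by N) _ F _ id) => e /Fz.
Qed.

Section Composition.
Context (N : vs_norm Y) (U : {linear Y -> Y}) (Uinj : injective U).

Fact norm_compD x y : N (U (x + y)) <= N (U x) + N (U y).
Proof. by rewrite linearD norm_ofD. Qed.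

Fact norm_compZ a x : N (U (a *: x)) = `|a| * N (U x).
Proof. by rewrite linearZ norm_ofZ. Qed.

Fact norm_comp_eq0 x : N (U x) = 0 -> x = 0.
Proof. by move/norm_of_eq0 => Ux; apply: Uinj; rewrite Ux linear0. Qed.

Definition norm_comp := VsNorm norm_compD norm_compZ norm_comp_eq0.

(** [U] carries Cauchy filters for [norm_comp] to Cauchy filters for [N]; surjectivity pulls the
    limit back. *)
Lemma complete_norm_comp :
  range U = setT -> complete_norm N -> complete_norm norm_comp.
Proof.
move=> Us /complete_normP cN; apply/complete_normP => F FF Fc.
have [|w Fw] := cN (U @ F) _.
  move=> e /Fc[x Fx]; exists (U x).
  suff : F [set y | N (U x - U y) < e] by [].
  by move: Fx; apply: filterS => y /=; rewrite -linearB.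
have [z _ zw] : range U w by rewrite Us.
exists z => e /Fw Fe; have : F [set y | N (w - U y) <= e] by [].
by apply: filterS => y /=; rewrite -zw -linearB.
Qed.

End Composition.
End CompleteNorms.

(** * The Banach space of bounded sequences with tail in [L] *)

Section BoundedSequences.
Context {R : realType} {X : completeNormedModType R[i]} {L : set X}.
Context (Lsub : linear_subspace L).
Lemma linear_subspace0 : L 0.
Proof. by case: Lsub => /set_mem. Qed.

Lemma linear_subspaceP (a : R[i]) u v : L u -> L v -> L (a *: u + v).
Proof.
by case: Lsub => _ /(_ a u v) LP Lu Lv; apply/set_mem/LP; apply/mem_set.
Qed.

(* [Lsub] occurs as a phantom argument so that the module structure of the
   subtype below can be inferred from its name. *)
Definition ext_seq of linear_subspace L : {pred nat -> X} := fun y =>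
  `[< (forall n, L (y n.+1)) /\ exists M, forall n, `|y n| <= M >].

Fact ext_seq_submod_closed : GRing.submod_closed (ext_seq Lsub).
Proof.
split.
  apply/asboolP; split=> [n|]; first exact: linear_subspace0.
  by exists 0 => n; rewrite normr0.
move=> a u v /asboolP[Lu [Mu uM]] /asboolP[Lv [Mv vM]].
apply/asboolP; split=> [n|]; first exact: linear_subspaceP.
exists (`|a| * Mu + Mv) => n.
by rewrite (le_trans (ler_normD _ _))// normrZ lerD// ler_wpM2l.
Qed.

HB.instance Definition _ := GRing.isSubmodClosed.Build _ _ (ext_seq Lsub)
  ext_seq_submod_closed.

Record ext_space := ExtSpace {
  ext_val :> nat -> X;
  _ : ext_val \in ext_seq Lsub }.
Arguments ExtSpace {_} _.

HB.instance Definition _ := [isSub for ext_val].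
HB.instance Definition _ := [Choice of ext_space by <:].
HB.instance Definition _ := [SubChoice_isSubLmodule of ext_space by <:].

Implicit Types y z : ext_space.

Lemma ext_val_tail y n : L (y n.+1).
Proof. by case: y => y /= /asboolP[]. Qed.

Lemma ext_val_bounded y : exists M, forall n, `|y n| <= M.
Proof. by case: y => y /= /asboolP[]. Qed.

Lemma ext_valD y z n : (y + z) n = y n + z n.
Proof. by rewrite -[LHS]/(val (y + z) n) raddfD. Qed.

Lemma ext_valB y z n : (y - z) n = y n - z n.
Proof. by rewrite -[LHS]/(val (y - z) n) raddfB. Qed.

Lemma ext_valZ (a : R[i]) y n : (a *: y) n = a *: y n.
Proof. by rewrite -[LHS]/(val (a *: y) n) linearZ. Qed.

Lemma ext_valP y z : (forall n, y n = z n) -> y = z.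
Proof. by move=> yz; apply/val_inj/funext. Qed.

(** The order of [R[i]] is only partial, so the supremum is taken in [R]; [Re] loses nothing, norms
    being real. *)
Definition sup_norm y : R[i] := (sup (range (fun n => complex.Re `|y n|)))%:C.

Let ReK (x : X) : (complex.Re `|x|)%:C = `|x|.
Proof. by rewrite RRe_real// normr_real. Qed.

Lemma le_sup_norm y n : `|y n| <= sup_norm y.
Proof.
rewrite -ReK lecR; apply: ub_le_sup; last by exists n.
have [M yM] := ext_val_bounded y; exists (complex.Re M) => _ [k _ <-].
by have := yM k; rewrite lecE => /andP[].
Qed.

Lemma sup_norm_le y M : (forall n, `|y n| <= M) -> sup_norm y <= M.
Proof.
(* Lying above a norm makes [M] nonnegative, hence equal to its real part. *)
move=> yM; have M0 : 0 <= M := le_trans (normr_ge0 _) (yM 0).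
rewrite -(RRe_real (ger0_real M0)) lecR; apply: ge_sup.
  by exists (complex.Re `|y 0|), 0.
by move=> _ [k _ <-]; have := yM k; rewrite lecE => /andP[].
Qed.

Fact sup_normD y z : sup_norm (y + z) <= sup_norm y + sup_norm z.
Proof.
apply: sup_norm_le => n; rewrite ext_valD.
by rewrite (le_trans (ler_normD _ _))// lerD// le_sup_norm.
Qed.

Fact sup_normZ (a : R[i]) y : sup_norm (a *: y) = `|a| * sup_norm y.
Proof.
have Zle b z : sup_norm (b *: z) <= `|b| * sup_norm z.
  by apply: sup_norm_le => n; rewrite ext_valZ normrZ ler_wpM2l// le_sup_norm.
apply/le_anti; rewrite Zle /=; have [->|a0] := eqVneq a 0.
  by rewrite normr0 mul0r (le_trans (normr_ge0 _) (le_sup_norm _ 0)).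
(* The reverse inequality is [Zle] for the scalar [a^-1] and the vector [a *: y]. *)
rewrite -ler_pdivlMl ?normr_gt0// -normfV.
by rewrite -{1}[y](scalerK a0) Zle.
Qed.

Fact sup_norm_eq0 y : sup_norm y = 0 -> y = 0.
Proof.
move=> y0; apply: ext_valP => n; apply/eqP.
by rewrite -normr_le0 -y0 le_sup_norm.
Qed.

Definition ext_norm := VsNorm sup_normD sup_normZ sup_norm_eq0.

(** The limit is taken coordinatewise in [X]; closedness of [L] keeps its tail in [L]. *)
Lemma complete_ext_norm : closed L -> complete_norm ext_norm.
Proof.
move=> cL; apply/complete_normP => F FF Fc.
have lim n : exists l : X, (y : ext_space) n @[y --> F] --> l.
  apply/cvg_ex; apply: cauchy_cvg; apply: cauchy_exP => e /Fc[x Fx].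
  exists (x n).
  rewrite -ball_normE; suff : F [set y | `|x n - y n| < e] by [].
  move: Fx; apply: filterS => y /=.
  by apply: le_lt_trans; rewrite -ext_valB le_sup_norm.
have {lim}[z Fz] := choice lim.
(* A bound uniform in [n]: compare [x] and [z] through some [y] that is near [x] in norm and near
   [z] at coordinate [n]. *)
have zle (e : R[i]) x n :
    F [set y | ext_norm (x - y) <= e] -> `|x n - z n| <= e.
  move=> Fx; apply/ler_addgt0Pr => d d0.
  have Fzd : F [set y | `|z n - y n| <= d].
    exact: (cvgrPdist_le _ _).1 (Fz n) d d0.
  have [y [/= xy zy]] := filter_ex (filterI Fx Fzd).
  rewrite -(subrKA (y n)) (le_trans (ler_normD _ _))// lerD//; last first.
    by rewrite distrC.
  by rewrite (le_trans _ xy)// -ext_valB le_sup_norm.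
have zE : z \in ext_seq Lsub.
  apply/asboolP; split=> [n|].
    apply: (closed_cvg _ cL _ _ (Fz n.+1)).
    by apply: nearW => y; exact: ext_val_tail.
  (* One ball of radius 1 suffices: [z] stays within 1 of the bounded sequence [x]. *)
  have [x Fx] := Fc 1 ltr01; exists (sup_norm x + 1) => n.
  rewrite -[z n](subKr (x n)) (le_trans (ler_normB _ _))// lerD ?le_sup_norm//.
  by apply: zle; move: Fx; apply: filterS => y /ltW.
exists (ExtSpace zE) => e e0.
have [x Fx] := Fc (e / 2) (divr_gt0 e0 (ltr0n _ 2)).
move: (Fx); apply: filterS => y /ltW yx; apply: sup_norm_le => n.
rewrite ext_valB -(subrKA (x n)) (le_trans (ler_normD _ _))// [e]splitr lerD//.
  by rewrite distrC zle//; move: Fx; apply: filterS => ? /ltW.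
by rewrite -ext_valB (le_trans (le_sup_norm _ _)).
Qed.

Definition ext_embed_seq (x : X) : nat -> X := fun n => if n is 0 then x else 0.

Fact ext_embed_subproof x : ext_embed_seq x \in ext_seq Lsub.
Proof.
apply/asboolP; split=> [n|]; first exact: linear_subspace0.
by exists `|x| => -[|n] /=; rewrite ?normr0.
Qed.

Definition ext_embed x := ExtSpace (ext_embed_subproof x).

Fact ext_embed_linear : linear ext_embed.
Proof.
move=> a u v; apply: ext_valP => n; rewrite ext_valD ext_valZ /=.
by case: n => [|n] //=; rewrite scaler0 addr0.
Qed.

HB.instance Definition _ :=
  GRing.isLinear.Build _ _ _ _ ext_embed ext_embed_linear.

Lemma ext_norm_embed x : ext_norm (ext_embed x) = `|x|.
Proof.
apply/le_anti/andP; split; last exact: (le_sup_norm (ext_embed x) 0).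
by apply: sup_norm_le => -[|n] //=; rewrite normr0.
Qed.

(** * The bijection [U] and its intertwining with [V] *)

Section Shift.
Context (V : {linear X -> X}) (Viso : forall x, `|V x| = `|x|).

Definition ext_shift_seq y : nat -> X :=
  fun n => if n is 0 then V (y 0) + y 1 else y n.+1.

Fact ext_shift_subproof y : ext_shift_seq y \in ext_seq Lsub.
Proof.
apply/asboolP; split=> [n|]; first exact: ext_val_tail.
have [M yM] := ext_val_bounded y; exists (M + M) => -[|n] /=.
  by rewrite (le_trans (ler_normD _ _))// lerD// Viso.
by rewrite (le_trans (yM _))// lerDl (le_trans (normr_ge0 _) (yM 0)).
Qed.

Definition ext_shift y := ExtSpace (ext_shift_subproof y).

Lemma ext_shift0 y : ext_shift y 0 = V (y 0) + y 1.
Proof. by []. Qed.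

Lemma ext_shiftS y n : ext_shift y n.+1 = y n.+2.
Proof. by []. Qed.

Fact ext_shift_linear : linear ext_shift.
Proof.
move=> a u v; apply: ext_valP => -[|n]; last first.
  by rewrite ext_valD ext_valZ !ext_shiftS ext_valD ext_valZ.
rewrite ext_valD ext_valZ !ext_shift0 !ext_valD !ext_valZ.
by rewrite linearP scalerDr addrACA.
Qed.

HB.instance Definition _ :=
  GRing.isLinear.Build _ _ _ _ ext_shift ext_shift_linear.

(** On the kernel, [V (y 0) = - y 1] lies in both [range V] and [L], so it vanishes, and [y 0] with
    it. *)
Lemma ext_shift_inj : range V `&` L = [set 0] -> injective ext_shift.
Proof.
move=> VL0; apply: raddf_inj => y y0.
have yE n : ext_shift y n = 0 by rewrite y0.
have y1 : V (y 0) = 0.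
  suff : (range V `&` L) (V (y 0)) by rewrite VL0.
  split; first by exists (y 0).
  have -> : V (y 0) = -1 *: y 1 + 0.
    by rewrite addr0 scaleN1r; apply/eqP; rewrite -addr_eq0; apply/eqP/(yE 0).
  apply: linear_subspaceP; first exact: (ext_val_tail y 0).
  exact: linear_subspace0.
apply: ext_valP => -[|[|n]].
- by apply/eqP; rewrite -normr_eq0 -Viso y1 normr0.
- by have := yE 0; rewrite ext_shift0 y1 add0r.
- exact: (yE n.+1).
Qed.

Lemma ext_shift_surj : direct_sum (range V) L -> range ext_shift = setT.
Proof.
case=> _ _ _ VL; apply/seteqP; split=> // z _.
have [_ [l [[x _ <-] Ll zE]]] := VL (z 0).
(* The preimage is [(x, l, z 1, z 2, ...)]: the last branch has [k >= 1], so [z 0], which may lie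
   outside [L], enters only through [V x + l]. *)
pose y n := match n with 0 => x | 1 => l | k.+1 => z k end.
have yE : y \in ext_seq Lsub.
  apply/asboolP; split=> [[|n]|] //=; first exact: ext_val_tail.
  have [M zM] := ext_val_bounded z.
  have M0 : 0 <= M := le_trans (normr_ge0 _) (zM 0).
  exists (`|x| + `|l| + M) => -[|[|n]] /=.
  - by rewrite -addrA lerDl addr_ge0.
  - by rewrite addrAC lerDr addr_ge0.
  - by rewrite (le_trans (zM _))// lerDr addr_ge0.
by exists (ExtSpace yE) => //; apply: ext_valP => -[|n] /=.
Qed.

Lemma ext_shift_embed x : ext_shift (ext_embed x) = ext_embed (V x).
Proof. by apply: ext_valP => -[|n] //=; rewrite addr0. Qed.

End Shift.
End BoundedSequences.

Theorem theorem6p9 (R : realType) (X : completeNormedModType R[i])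
    (V : {linear X -> X}) (hV : wold_isometry V) :
  exists (Y : lmodType R[i]) (Nsigma NY : vs_norm Y)
         (U : {linear Y -> Y}) (Lam : {linear X -> Y}),
    [/\ complete_norm Nsigma, complete_norm NY,
        range U = setT /\ (forall y : Y, NY (U y) = Nsigma y),
        (forall x : X, Nsigma (Lam x) = `|x|) /\
        (forall x : X, NY (Lam x) = `|x|) &
        forall x : X, U (Lam x) = Lam (V x)].
Proof.
have [Viso [L [_ [_ [[cL VL _ _ _] _]]]]] := hV.
have [_ Lsub VL0 _] := VL.
have Uinj := ext_shift_inj Lsub V Viso VL0.
exists (ext_space Lsub).
exists (norm_comp (ext_norm Lsub) (ext_shift Lsub V Viso) Uinj).
exists (ext_norm Lsub), (ext_shift Lsub V Viso), (ext_embed Lsub).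
have cN := complete_ext_norm Lsub cL.
split.
- by apply: complete_norm_comp => //; exact: ext_shift_surj.
- exact: cN.
- by split=> //; exact: ext_shift_surj.
- split=> x; last exact: ext_norm_embed.
  (* Unfolding [Nsigma] as [NY \o U] turns the left side into the norm of the embedded [V x]. *)
  by rewrite -[LHS]/(ext_norm Lsub (ext_shift Lsub V Viso (ext_embed Lsub x)))
     ext_shift_embed ext_norm_embed Viso.
- exact: ext_shift_embed.
Qed.
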